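(* Let $L$ be a finite dimensional Lie superalgebra over the field $\mathbb{C}$ of complex numbers. Then $D(\operatorname{nil}(L))\subseteq E(L)$ for every $D\in\operatorname{Der}(L)$.
   Context: A Lie superalgebra over $\mathbb{C}$ is a $\mathbb{Z}_2$-graded vector space $L=L_{\overline 0}\oplus L_{\overline 1}$ with a bilinear bracket satisfying $[L_\alpha,L_\beta]\subseteq L_{\alpha+\beta}$, $[x,y]=-(-1)^{|x||y|}[y,x]$ and $[x,[y,z]]=[[x,y],z]+(-1)^{|x||y|}[y,[x,z]]$ for homogeneous $x,y,z$. ''Subalgebra'' always means $\mathbb{Z}_2$-graded subalgebra, and $\langle z,x\rangle$ denotes the subalgebra of $L$ generated by $z$ and $x$, i.e. the smallest $\mathbb{Z}_2$-graded subalgebra containing $z$ and $x$ (which need not be homogeneous). A Lie superalgebra $M$ is nilpotent if $M^k=0$ for some $k\ge 1$, where $M^1=M$, $M^{k+1}=[M^k,M]$. The nilpotentizer of $L$ is the subset $\operatorname{nil}(L)=\{x\in L\mid \langle z,x\rangle\text{ is nilpotent for all } z\in L\}$. For $x\in L$, $\operatorname{ad}_x(y)=[x,y]$ and $E_L(x)=\{y\in L\mid (\operatorname{ad}_x)^n(y)=0\text{ for some } n\in\mathbb{N}\}$. An element $y\in L$ is an Engel element of $L$ if $y\in E_L(x)$ for all $x\in L$; $E(L)$ is the set of all Engel elements of $L$. $\operatorname{Der}(L)$ is the derivation algebra of the Lie superalgebra $L$, i.e. $\operatorname{Der}(L)=\operatorname{Der}(L)_{\overline 0}\oplus\operatorname{Der}(L)_{\overline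 1}$, where $\operatorname{Der}(L)_{\alpha}$ consists of the linear maps $D:L\to L$ with $D(L_\beta)\subseteq L_{\alpha+\beta}$ and $D([x,y])=[D(x),y]+(-1)^{\alpha|x|}[x,D(y)]$ for homogeneous $x\in L$ and all $y\in L$. *)

(* Defs.v *)
From HB Require Import structures.
From mathcomp Require Import all_boot all_order all_algebra.
From mathcomp Require Export sesquilinear complex reals.
From mathcomp Require Export boolp classical_sets.
Set Implicit Arguments. Unset Strict Implicit. Unset Printing Implicit Defensive.
Import GRing.Theory.
Local Open Scope ring_scope.

(* Parities are booleans, [true] being the odd one, so that the sum of parities
   is [a (+) b] and the Koszul sign is [(-1) ^+ (a && b)].  Finite dimension is
   part of [vectType].  The base field has characteristic 0, so that no extra
   axioms on odd elements (as in characteristic 2 or 3) are called for. *)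
Record lieSuperalgebra (K : numFieldType) := LieSuperalgebra {
  lsa_carrier :> vectType K;
  homog : bool -> {vspace lsa_carrier};
  lbr : {bilinear lsa_carrier -> lsa_carrier -> lsa_carrier};
  homog_cap : (homog false :&: homog true = 0)%VS;
  homog_add : (homog false + homog true = fullv)%VS;
  lbr_homog : forall (a b : bool) (x y : lsa_carrier),
    x \in homog a -> y \in homog b -> lbr x y \in homog (a (+) b);
  lbr_skew : forall (a b : bool) (x y : lsa_carrier),
    x \in homog a -> y \in homog b ->
    lbr x y = - ((-1) ^+ (a && b) *: lbr y x);
  lbr_jacobi : forall (a b c : bool) (x y z : lsa_carrier),
    x \in homog a -> y \in homog b -> z \in homog c ->
    lbr x (lbr y z) = lbr (lbr x y) z + (-1) ^+ (a && b) *: lbr y (lbr x z)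
}.

Section LieSuperalgebraTheory.
Variables (K : numFieldType) (L : lieSuperalgebra K).
Implicit Types (U W M : {vspace L}) (x y z : L).

Definition graded_subalgebra M : Prop :=
  [/\ (M = M :&: homog L false + M :&: homog L true)%VS
    & forall x y, x \in M -> y \in M -> lbr L x y \in M].

Definition is_subalg_gen z x M : Prop :=
  [/\ graded_subalgebra M, z \in M, x \in M
    & forall N : {vspace L}, graded_subalgebra N -> z \in N -> x \in N ->
        (M <= N)%VS].

Lemma graded_subalgebra_full : graded_subalgebra fullv.
Proof.
split; last by move=> *; exact: memvf.
by rewrite !(capv_idPr (subvf _)) homog_add.
Qed.

Lemma graded_subalgebra_cap M N :
  graded_subalgebra M -> graded_subalgebra N -> graded_subalgebra (M :&: N)%VS.
Proof.
move=> [gM cM] [gN cN]; split; last first.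
  move=> x y; rewrite !memv_cap => /andP[xM xN] /andP[yM yN].
  by rewrite cM ?cN.
apply/eqP; rewrite eqEsubv subv_add !capvSl andbT.
rewrite andbT; apply/subvP => y; rewrite memv_cap => /andP[].
rewrite {1}gM => /memv_addP[u0 + [u1 + def_y]].
rewrite !memv_cap => /andP[u0M u0h] /andP[u1M u1h].
rewrite {1}gN => /memv_addP[w0 + [w1 + def_y']].
rewrite !memv_cap => /andP[w0N w0h] /andP[w1N w1h].
have E : u0 - w0 = w1 - u1.
  apply/eqP; rewrite subr_eq addrAC -subr_eq opprK; apply/eqP.
  by rewrite -def_y def_y' addrC.
have : u0 - w0 \in (homog L false :&: homog L true)%VS.
  by rewrite memv_cap rpredB // E rpredB.
rewrite homog_cap memv0 => /eqP d0.
have e0 : u0 = w0 by apply/eqP; rewrite -subr_eq0 d0.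
have e1 : u1 = w1 by apply/esym/eqP; rewrite -subr_eq0 -E d0.
rewrite def_y memv_add // !memv_cap ?u0M ?u0h ?u1M ?u1h ?andbT /=.
  by rewrite e0.
by rewrite e1.
Qed.

Lemma subalg_gen_exists z x : exists M, is_subalg_gen z x M.
Proof.
pose P M := [/\ graded_subalgebra M, z \in M & x \in M].
have exP : exists n, `[< exists2 M, P M & \dim M = n >].
  exists (\dim {:L}); apply/asboolP; exists fullv => //.
  by split; [exact: graded_subalgebra_full | exact: memvf | exact: memvf].
have [n /asboolP[M [gM zM xM] dimM] minM] := ex_minnP exP.
exists M; split=> // N gN zN xN.
have /minM : `[< exists2 M', P M' & \dim M' = \dim (M :&: N)%VS >].
  apply/asboolP; exists (M :&: N)%VS => //.
  by split; [exact: graded_subalgebra_cap | rewrite memv_cap zM |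
             rewrite memv_cap xM].
rewrite -dimM => le_dim.
have /eqP <- : (M :&: N == M)%VS by rewrite eqEdim capvSl.
exact: capvSr.
Qed.

Definition subalg_gen z x : {vspace L} := sval (cid (subalg_gen_exists z x)).

Lemma subalg_genP z x : is_subalg_gen z x (subalg_gen z x).
Proof. exact: svalP (cid (subalg_gen_exists z x)). Qed.

(* The span of all brackets [u, w] with u in U and w in W. *)
Definition lbrv U W : {vspace L} :=
  <<[seq lbr L u w | u <- vbasis U, w <- vbasis W]>>%VS.

(* The index is shifted by one: [lower_central M k] is M^(k+1). *)
Fixpoint lower_central M (k : nat) : {vspace L} :=
  if k is k'.+1 then lbrv (lower_central M k') M else M.

Definition nilpotent_subalg M : Prop := exists k, lower_central M k = 0%VS.

Definition nilpotentizer : set L :=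
  [set x | forall z, nilpotent_subalg (subalg_gen z x)].

Definition engelizer x : set L :=
  [set y | exists n : nat, iter n (lbr L x) y = 0].

Definition engel_elements : set L := [set y | forall x, engelizer x y].

Definition homog_derivation (a : bool) (D : 'End(L)) : Prop :=
  (forall (b : bool) y, y \in homog L b -> D y \in homog L (a (+) b)) /\
  (forall (b : bool) x y, x \in homog L b ->
     D (lbr L x y) = lbr L (D x) y + (-1) ^+ (a && b) *: lbr L x (D y)).

Definition derivation (D : 'End(L)) : Prop :=
  exists D0 D1 : 'End(L),
    [/\ homog_derivation false D0, homog_derivation true D1 & D = D0 + D1].

End LieSuperalgebraTheory.

Arguments nilpotentizer {K} L.
Arguments engel_elements {K} L.

(* Main.v *)
Require Import Defs.
From mathcomp Require Import all_boot all_order all_algebra.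
Set Implicit Arguments. Unset Strict Implicit. Unset Printing Implicit Defensive.
Import GRing.Theory Num.Theory.
Local Open Scope classical_set_scope.
Local Open Scope ring_scope.

(** Write ad_z for [z, -], and let D be the sum of its homogeneous parts D0 and
D1.  Every x in nil(L) is an Engel element, since z and x lie in the nilpotent
algebra <z, x>, and for a fixed z the elements on which ad_z is nilpotent form
a subspace.  So it suffices to treat D0 and D1 separately.

Even derivations preserve E(L), by polarisation.  With N = dim L, the vector
(ad_z + t ad_w)^N x vanishes for every scalar t, because x is an Engel element
and N is a uniform bound for the order of nilpotency ([nilpotent_at_dim]).
Hence the coefficient of t, the sum over i + j = N - 1 of
ad_z^i ad_w ad_z^j x, vanishes ([iter_variation_eq0]).  For w = D0 z this sum
is the difference between D0 (ad_z^N x) and ad_z^N (D0 x), so the latter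
is zero ([engel_even_derivation]).

For D1 this computation breaks down, as D1 supercommutes with the even and odd
components of ad_z with different signs.  What helps is that the existence of
a single x in nil(L) is a strong condition on L: all algebras <u + w, x>
are nilpotent, so ad_u is nilpotent at w for all even u and odd w
([nilpotentizer_even_odd]).  In particular ad_u is nilpotent at D1 u.  The
elements at which ad_u is nilpotent are closed under the bracket, so by
D1 [u, v] = [D1 u, v] + [u, D1 v] they are also closed under D1
([engelizer_odd_derivation]).

Now fix z and put H = <z, x>, a nilpotent algebra.  Let M be the space of all
v such that ad_u is nilpotent at v for every even u in H.  It is stable under
H, and it contains D1 x by the previous paragraph, so it remains to
pass from the even elements of H to all of H.  This is Engel's theorem, in a
form that is easy for a nilpotent H ([nilpotent_subalg_acts_nilpotently]):
odd elements y act nilpotently as well, as ad_y^2 is half of ad_[y, y], and a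
graded ideal of H that acts nilpotently on M can be enlarged by homogeneous
elements that are central modulo it ([acts_nilpotently_add]).  Thus H acts
nilpotently on M; in particular ad_z is nilpotent at D1 x. *)

(** * Local nilpotency and polarisation *)

Section LinearAlgebra.
Variables (K : numFieldType) (V : vectType K).
Implicit Types (f g : {linear V -> V}) (u v x : V).

(** Turns a linear condition into a subspace that the vector space operations
apply to: a subspace of maximal dimension among those on which the condition
holds contains every vector satisfying it. *)
Lemma vspace_comprehension (P : V -> Prop) :
  P 0 -> (forall a u v, P u -> P v -> P (a *: u + v)) ->
  exists U : {vspace V}, forall v, v \in U <-> P v.
Proof.
move=> P0 Plin.
pose good n := `[< exists2 U : {vspace V}, (forall v, v \in U -> P v)
                   & \dim U = n >].
have ex_good : exists n, good n.
  exists 0%N; apply/asboolP; exists 0%VS; last exact: dimv0.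
  by move=> v; rewrite memv0 => /eqP->.
have good_le n : good n -> (n <= \dim {:V})%N.
  by move=> /asboolP[U _ <-]; exact: dimvS (subvf U).
case: (ex_maxnP ex_good good_le) => n /asboolP[U UP dimU] maxn.
exists U => v; split; first exact: UP.
move=> Pv; have: good (\dim (<[v]> + U)%VS).
  apply/asboolP; exists (<[v]> + U)%VS => // w /memv_addP[_ /vlineP[a ->]].
  by case=> u uU ->; apply: Plin => //; apply: UP.
move/maxn; rewrite -dimU => le_dim.
have /eqP -> : (U == <[v]> + U)%VS by rewrite eqEdim addvSr le_dim.
exact: subvP (addvSl _ _) _ (memv_line v).
Qed.

Lemma iter0_linear f n : iter n f 0 = 0.
Proof. by elim: n => //= n ->; rewrite linear0. Qed.

Lemma lfun_iter f n : exists F : 'End(V), forall v, F v = iter n f v.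
Proof.
elim: n => [|n [F FE]]; first by exists \1%VF => v; rewrite id_lfunE.
by exists (linfun f \o F)%VF => v; rewrite comp_lfunE lfunE /= FE.
Qed.

Lemma iter0_leq f m n v : (m <= n)%N -> iter m f v = 0 -> iter n f v = 0.
Proof. by move=> /subnK <- fv; rewrite iterD fv iter0_linear. Qed.

(** If f^n kills f v, ..., f^n v but not v, then v is not in their span. *)
Lemma free_traject f n v :
  iter n f v != 0 -> iter n.+1 f v = 0 -> free (traject f v n.+1).
Proof.
elim: n v => [|n IHn] v nz z; 
  first by rewrite /= free_cons nil_free span_nil memv0 nz.
rewrite trajectS free_cons IHn ?andbT -?iterSr //.
apply: contra nz => v_in; apply/eqP.
have [F FE] := lfun_iter f n.+1.
have: (<<traject f (f v) n.+1>> <= lker F)%VS.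
  apply/span_subvP => _ /trajectP[i _ ->].
  by rewrite memv_ker FE -iterSr -iterD addnC addSnnS iterD z iter0_linear.
by move/subvP/(_ v v_in); rewrite memv_ker FE => /eqP.
Qed.

(** A bound that does not depend on f; polarisation needs one exponent for all
the operators of a line. *)
Lemma nilpotent_at_dim f n v : iter n f v = 0 -> iter (\dim {:V}) f v = 0.
Proof.
move=> fnv; have exn : exists n, iter n f v == 0 by exists n; apply/eqP.
case: (ex_minnP exn) => -[|m] /eqP fmv minm; first exact: (iter0_leq _ fmv).
apply: (iter0_leq _ fmv).
have nz : iter m f v != 0 by apply: contraT; rewrite negbK => /minm; rewrite ltnn.
have := free_traject nz fmv; rewrite /free size_traject => /eqP <-.
exact: dimvS (subvf _).
Qed.

(** In each coordinate the sum is a polynomial with infinitely many roots. *)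
Lemma vector_polynomial_eq0 n (c : nat -> V) :
  (forall t : K, \sum_(k < n) t ^+ k *: c k = 0) ->
  forall k, (k < n)%N -> c k = 0.
Proof.
move=> c0 k ltkn; rewrite (coord_vbasis (memvf (c k))).
apply: big1 => i _; pose p := \poly_(j < n) coord (vbasis {:V}) i (c j).
suff p0 : p = 0.
  have := coef_poly n (fun j => coord (vbasis {:V}) i (c j)) k.
  by rewrite ltkn -/p p0 coef0 => <-; rewrite scale0r.
apply/eqP; apply: contraT => nzp.
have := max_poly_roots (rs := [seq m%:R | m <- iota 0 (size p)]) nzp.
rewrite size_map size_iota ltnn => -> //; last first.
  rewrite map_inj_uniq ?iota_uniq //.
  by move=> a b /eqP; rewrite eqr_nat => /eqP.
apply/allP => _ /mapP[m _ ->]; apply/rootP.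
rewrite horner_poly -[RHS](linear0 (coord (vbasis {:V}) i)) -(c0 m%:R) linear_sum.
by apply: eq_bigr => j _; rewrite linearZ /= mulrC.
Qed.

(** The derivative at t = 0 of (f + t g)^n x, that is, the sum of
f^i (g (f^j x)) over i + j = n - 1. *)
Fixpoint iter_variation f g x n : V :=
  if n is m.+1 then f (iter_variation f g x m) + g (iter m f x) else 0.

Lemma iter_variation_eq0 f g x n :
  (forall t : K, iter n (fun v => f v + t *: g v) x = 0) ->
  iter_variation f g x n = 0.
Proof.
have [c [cE c1]] : exists c : nat -> V,
    (forall t, iter n (fun v => f v + t *: g v) x = \sum_(k < n.+2) t ^+ k *: c k)
    /\ (c 0%N = iter n f x) /\ c 1%N = iter_variation f g x n.
  elim: n => [|n [c [cE [c0 c1]]]].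
    exists (fun k => if k is 0 then x else 0); split=> // t.
    by rewrite !big_ord_recl big_ord0 /= scale1r scaler0 !addr0.
  (* The bound drops the coefficient of index n + 2, unconstrained by cE. *)
  exists (fun k => if k is k'.+1 then
            (if (k <= n.+1)%N then f (c k) else 0) + g (c k') else f (c 0%N)).
  split; last by rewrite /= c0 c1.
  move=> t; rewrite iterS cE !linear_sum /=.
  rewrite [RHS]big_ord_recl /= expr0 scale1r.
  under [in RHS]eq_bigr => i _ do rewrite scalerDr.
  rewrite big_split /= addrA; congr (_ + _).
    rewrite big_ord_recl expr0 scale1r; congr (_ + _).
    rewrite [RHS]big_ord_recr /= ltnn scaler0 addr0.
    by apply: eq_bigr => i _; rewrite linearZ /bump /= add1n ltn_ord.
  by apply: eq_bigr => i _; rewrite linearZ scalerA -exprS.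
move=> it0; rewrite -c1.2; apply: (@vector_polynomial_eq0 n.+2) => // t.
by rewrite -cE.
Qed.

(** This identity makes [iter_variation] the obstruction to D preserving the
vectors killed by f^n. *)
Lemma iter_twisted_derivation f g (D : V -> V) x n :
  (forall v, D (f v) = g v + f (D v)) ->
  D (iter n f x) = iter_variation f g x n + iter n f (D x).
Proof.
move=> Df; elim: n => [|n IHn]; first by rewrite add0r.
by rewrite /= Df IHn linearD /= addrCA addrA.
Qed.

End LinearAlgebra.

(** * Graded subspaces and their brackets *)

Section LieSuperalgebra.
Variables (K : numFieldType) (L : lieSuperalgebra K).
Implicit Types (U V W M H : {vspace L}) (x y z u v w : L).
Local Notation "[< x , y >]" := (lbr L x y) (format "[< x ,  y >]").

Lemma lbrv_mem U W u w : u \in U -> w \in W -> [<u, w>] \in lbrv U W.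
Proof.
move=> /coord_vbasis -> /coord_vbasis ->.
rewrite linear_sumlz memv_suml // => i _; rewrite linear_sumr memv_suml // => j _.
rewrite linearZl_LR linearZr_LR !memvZ // memv_span //.
by apply: allpairs_f; rewrite mem_nth // size_tuple.
Qed.

Lemma lbrv_subP U W (X : {vspace L}) :
  (forall u w, u \in U -> w \in W -> [<u, w>] \in X) -> (lbrv U W <= X)%VS.
Proof.
move=> UWX; apply/span_subvP => _ /allpairsP[[u w] [/= uU wW ->]].
by apply: UWX; apply: vbasis_mem.
Qed.

Lemma lbrvS U1 U2 W1 W2 :
  (U1 <= U2)%VS -> (W1 <= W2)%VS -> (lbrv U1 W1 <= lbrv U2 W2)%VS.
Proof.
move=> /subvP U12 /subvP W12.
by apply: lbrv_subP => u w /U12 uU2 /W12 wW2; apply: lbrv_mem.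
Qed.

Definition graded U : Prop := U = (U :&: homog L false + U :&: homog L true)%VS.

(** Reduces additive properties of graded subspaces to homogeneous elements, for
which skew-symmetry and the Jacobi identity are available. *)
Lemma graded_ind U (Q : L -> Prop) : graded U ->
  (forall u v, Q u -> Q v -> Q (u + v)) ->
  (forall a u, u \in U -> u \in homog L a -> Q u) ->
  forall u, u \in U -> Q u.
Proof.
move=> gU QD Qh u; rewrite gU => /memv_addP[u0 + [u1 + ->]].
rewrite !memv_cap => /andP[u0U u0h] /andP[u1U u1h].
by apply: QD; [apply: Qh u0h | apply: Qh u1h].
Qed.

Lemma graded_full : graded fullv.
Proof. by case: (graded_subalgebra_full L). Qed.

Lemma graded_lbrv U W : graded U -> graded W -> graded (lbrv U W).
Proof.
move=> gU gW; apply/eqP; rewrite eqEsubv subv_add !capvSl !andbT.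
apply: lbrv_subP => u w + wW; move: u.
apply: (graded_ind gU) => [u v uS vS | a u uU ua]; first by rewrite linearDl rpredD.
move: w wW; apply: (graded_ind gW) => [v w vS wS | b w wW wb].
  by rewrite linearDr rpredD.
have: [<u, w>] \in (lbrv U W :&: homog L (a (+) b))%VS.
  by rewrite memv_cap lbrv_mem // (lbr_homog ua wb).
by case: (a (+) b) => h;
  [apply: subvP (addvSr _ _) _ h | apply: subvP (addvSl _ _) _ h].
Qed.

Lemma graded_add U W : graded U -> graded W -> graded (U + W)%VS.
Proof.
move=> gU gW; apply/eqP; rewrite eqEsubv [X in _ && X]subv_add !capvSl !andbT.
rewrite subv_add; apply/andP.
by split; [rewrite {1}gU | rewrite {1}gW];
   rewrite addvS // capvS // ?addvSl ?addvSr.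
Qed.

Lemma graded_line a y : y \in homog L a -> graded <[y]>%VS.
Proof.
move=> ya; apply/eqP; rewrite eqEsubv subv_add !capvSl !andbT -memvE.
have: y \in (<[y]> :&: homog L a)%VS by rewrite memv_cap memv_line.
by case: a ya => _ h;
  [apply: subvP (addvSr _ _) _ h | apply: subvP (addvSl _ _) _ h].
Qed.

Lemma lbrv_swap U W : graded U -> graded W -> (lbrv U W <= lbrv W U)%VS.
Proof.
move=> gU gW; apply: lbrv_subP => u w + wW; move: u.
apply: (graded_ind gU) => [u v uS vS | a u uU ua]; first by rewrite linearDl rpredD.
move: w wW; apply: (graded_ind gW) => [v w vS wS | b w wW wb].
  by rewrite linearDr rpredD.
by rewrite (lbr_skew ua wb) rpredN memvZ // lbrv_mem.
Qed.

Lemma graded_lower_central H k : graded H -> graded (lower_central H k).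
Proof. by move=> gH; elim: k => //= k IHk; apply: graded_lbrv. Qed.

Lemma lower_central_lbr H k h c : graded H ->
  h \in H -> c \in lower_central H k -> [<h, c>] \in lower_central H k.+1.
Proof.
move=> gH hH ck; apply: (subvP (lbrv_swap gH (graded_lower_central k gH))).
exact: lbrv_mem.
Qed.

(** The iterates of ad_h on H run through the lower central series. *)
Lemma nilpotent_subalg_engel H h v : graded H -> nilpotent_subalg H ->
  h \in H -> v \in H -> exists n, iter n (lbr L h) v = 0.
Proof.
move=> gH [k Hk0] hH vH; exists k; apply/eqP; rewrite -memv0 -Hk0.
by elim: k {Hk0} => //= k IHk; apply: lower_central_lbr.
Qed.

(** For an even u no sign occurs: ad_u is an ordinary derivation. *)
Lemma even_jacobi u x v : u \in homog L false ->
  [<u, [<x, v>]>] = [<[<u, x>], v>] + [<x, [<u, v>]>].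
Proof.
move=> u0; move: x (memvf x); apply: (graded_ind graded_full) => [x y | a x _ xa].
  by move=> ex ey; rewrite !(linearDl, linearDr) /= ex ey addrACA.
move: v (memvf v); apply: (graded_ind graded_full) => [v w | b v _ vb].
  by move=> ev ew; rewrite !linearDr /= ev ew addrACA.
by rewrite (lbr_jacobi u0 xa vb) scale1r.
Qed.

Lemma homog_jacobi a b x y v : x \in homog L a -> y \in homog L b ->
  [<x, [<y, v>]>] = [<[<x, y>], v>] + (-1) ^+ (a && b) *: [<y, [<x, v>]>].
Proof.
move=> xa yb; move: v (memvf v).
apply: (graded_ind graded_full) => [v w ev ew | c v _ vc].
  by rewrite !linearDr /= ev ew scalerDr addrACA.
exact: lbr_jacobi xa yb vc.
Qed.

(** By the Leibniz rule, the terms of ad_u^(m+n) [v, w] are brackets of ad_u^i v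
and ad_u^j w with i + j = m + n, so that m <= i or n <= j. *)
Lemma engelizer_lbr u v w : u \in homog L false ->
  engelizer u v -> engelizer u w -> engelizer u [<v, w>].
Proof.
move=> u0 [m umv] [n unw]; exists (m + n)%N.
suff aux p q v' w' : iter p (lbr L u) v' = 0 -> iter q (lbr L u) w' = 0 ->
  iter (p + q) (lbr L u) [<v', w'>] = 0 by exact: aux.
have [k] := ubnP (p + q); elim: k p q v' w' => // k IHk p q v' w' ltk.
case: p ltk => [|p] ltk; first by move=> z0 _; rewrite [v']z0 linear0l iter0_linear.
case: q ltk => [|q] ltk; first by move=> _ z0; rewrite [w']z0 linear0r iter0_linear.
move=> v0 w0; rewrite addSn iterSr even_jacobi //.
have [F FE] := lfun_iter (lbr L u) (p + q.+1).
have e1 : iter (p + q.+1) (lbr L u) [<[<u, v'>], w'>] = 0.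
  by apply: IHk => //; rewrite -iterSr.
have e2 : iter (p + q.+1) (lbr L u) [<v', [<u, w'>]>] = 0.
  by rewrite addnS -addSn; apply: IHk => //; [rewrite addnS in ltk | rewrite -iterSr].
by rewrite -FE linearD /= !FE e1 e2 addr0.
Qed.

Lemma engelizer_linear u a v w :
  engelizer u v -> engelizer u w -> engelizer u (a *: v + w).
Proof.
move=> [m /nilpotent_at_dim v0] [n /nilpotent_at_dim w0]; exists (\dim {:L}).
have [F FE] := lfun_iter (lbr L u) (\dim {:L}).
by rewrite -FE linearP /= !FE v0 w0 scaler0 addr0.
Qed.

(** * Engel's theorem for nilpotent subalgebras *)

(** A uniform condition on U: all products of m operators ad_u, with u in U and
m fixed, vanish on M. *)
Definition acts_nilpotently U M := exists m, iter m (lbrv U) M = 0%VS.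

Lemma acts_nilpotently_at U M u v : acts_nilpotently U M ->
  u \in U -> v \in M -> exists n, iter n (lbr L u) v = 0.
Proof.
move=> [m UM0] uU vM; exists m; apply/eqP; rewrite -memv0 -UM0.
by elim: m {UM0} => //= m IHm; apply: lbrv_mem.
Qed.

Lemma iter_lbrvS U V W m :
  (V <= W)%VS -> (iter m (lbrv U) V <= iter m (lbrv U) W)%VS.
Proof. by move=> VW; elim: m => //= m IHm; apply: lbrvS. Qed.

(** Each term of the chain M, [U, M], [U, [U, M]], ... is stable under U and y,
because ad_y normalises U.  On a quotient of consecutive terms U acts as zero,
so only y matters there, and y is nilpotent. *)
Lemma acts_nilpotently_add U y b M :
  graded U -> y \in homog L b -> (forall u, u \in U -> [<y, u>] \in U) ->
  (forall u v, u \in U -> v \in M -> [<u, v>] \in M) ->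
  (forall v, v \in M -> [<y, v>] \in M) ->
  (forall v, v \in M -> exists n, iter n (lbr L y) v = 0) ->
  acts_nilpotently U M -> acts_nilpotently (U + <[y]>)%VS M.
Proof.
move=> gU yb yU UM yM ynil [m]; set A := (U + <[y]>)%VS.
elim: m M UM yM ynil => [|m IHm] M UM yM ynil; first by exists 0%N.
rewrite iterSr => UM0; pose B := lbrv U M; rewrite -/B in UM0.
have BM : (B <= M)%VS by apply: lbrv_subP => u v; apply: UM.
have UB u v : u \in U -> v \in B -> [<u, v>] \in B.
  by move=> uU /(subvP BM); apply: lbrv_mem.
have yB v : v \in B -> [<y, v>] \in B.
  move=> vB; have: (B <= linfun (lbr L y) @^-1: B)%VS.
    apply: lbrv_subP => u w + wM; move: u.
    apply: (graded_ind gU) => [u u' uB u'B | a u uU ua].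
      by rewrite linearDl rpredD.
    rewrite -memv_preim lfunE /= (homog_jacobi _ yb ua) rpredD ?memvZ //.
      by apply: lbrv_mem => //; apply: yU.
    by apply: lbrv_mem => //; apply: yM.
  by move/subvP/(_ v vB); rewrite -memv_preim lfunE.
(* The induction on the length m of the chain replaces M by B = [U, M]. *)
have [p AB0] : acts_nilpotently A B.
  by apply: IHm => // v vB; apply: ynil; apply: subvP vB.
pose Y j : {vspace L} := iter j (fun W => linfun (lbr L y) @: W)%VS M.
have YP j w : w \in Y j -> exists2 v, v \in M & w = iter j (lbr L y) v.
  elim: j w => [|j IHj] w; first by exists w.
  by move=> /memv_imgP[_ /IHj[v vM ->] ->]; exists v; rewrite // lfunE.
have YM j : (Y j <= M)%VS.
  by apply/subvP => w /YP[v vM ->]; elim: j => //= j; apply: yM.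
have AY j : (iter j (lbrv A) M <= Y j + B)%VS.
  elim: j => [|j IHj]; first exact: addvSl.
  apply: lbrv_subP => _ w /memv_addP[u uU [_ /vlineP[c ->] ->]].
  move=> /(subvP IHj)/memv_addP[v vY [v' v'B ->]].
  have vM := subvP (YM j) _ vY.
  rewrite linearDl /= linearZl_LR /= [X in _ *: X]linearDr scalerDr addrCA.
  rewrite memv_add //; first by rewrite memvZ // -lfunE memv_img.
  rewrite rpredD ?memvZ ?yB // linearDr rpredD //.
    exact: lbrv_mem.
  exact: UB.
(* Modulo B the iterated action of A is that of y, which stops at dim L. *)
have Y0 : Y (\dim {:L}) = 0%VS.
  apply/eqP; rewrite -subv0; apply/subvP => w /YP[v vM ->].
  by have [n /nilpotent_at_dim ->] := ynil v vM; apply: mem0v.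
exists (p + \dim {:L})%N; apply/eqP; rewrite -subv0 -AB0 iterD.
by apply: iter_lbrvS; have := AY (\dim {:L}); rewrite Y0 add0v.
Qed.

(** By the super Jacobi identity, 2 ad_y^2 = ad_[y, y] for an odd y. *)
Lemma odd_lbr_iter y v n : y \in homog L true ->
  iter n (lbr L [<y, y>]) v = 0 -> iter n.*2 (lbr L y) v = 0.
Proof.
move=> y1; have yy w : [<y, [<y, w>]>] = 2%:R^-1 *: [<[<y, y>], w>].
  have two0 : 2%:R != 0 :> K by rewrite pnatr_eq0.
  apply: (scalerI two0); rewrite scalerA divff // scale1r scaler_nat mulr2n.
  by rewrite {1}(homog_jacobi _ y1 y1) expr1 scaleN1r subrK.
suff -> : iter n.*2 (lbr L y) v = 2%:R^-1 ^+ n *: iter n (lbr L [<y, y>]) v.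
  by move=> ->; rewrite scaler0.
elim: n => [|n IHn]; first by rewrite scale1r.
by rewrite doubleS !iterS IHn yy linearZ_LR scalerA -exprS.
Qed.

(** Take a graded ideal U of H, of maximal dimension among those acting
nilpotently on M.  If U is not H, some term of the lower central series is not
inside U while the next one is; a homogeneous y in the former but not in U
satisfies [H, y] <= U, so that U + <y> is a larger ideal of this kind. *)
Lemma nilpotent_subalg_acts_nilpotently H M :
  graded_subalgebra H -> nilpotent_subalg H ->
  (forall h v, h \in H -> v \in M -> [<h, v>] \in M) ->
  (forall u v, u \in H -> u \in homog L false -> v \in M -> engelizer u v) ->
  acts_nilpotently H M.
Proof.
move=> [gH cH] [k Hk0] HM Hnil.
pose good n := `[< exists2 U : {vspace L},
  [/\ graded U, (U <= H)%VS, (forall h u, h \in H -> u \in U -> [<h, u>] \in U)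
    & acts_nilpotently U M] & \dim U = n >].
have ex_good : exists n, good n.
  exists 0%N; apply/asboolP; exists 0%VS; last exact: dimv0.
  split; first by rewrite /graded !cap0v addv0.
  - exact: sub0v.
  - by move=> h u _; rewrite memv0 => /eqP ->; rewrite linear0r mem0v.
  exists 1%N; apply/eqP; rewrite -subv0; apply: lbrv_subP => u v.
  by rewrite memv0 => /eqP -> _; rewrite linear0l mem0v.
have good_le n : good n -> (n <= \dim {:L})%N.
  by move=> /asboolP[U _ <-]; exact: dimvS (subvf U).
case: (ex_maxnP ex_good good_le) => n /asboolP[U [gU UH HU Unil] dimU] maxn.
have [HleU|HnU] := boolP (H <= U)%VS.
  by rewrite (_ : H = U) //; apply/eqP; rewrite eqEsubv HleU.
have ex_j : exists j, (lower_central H j <= U)%VS by exists k; rewrite Hk0 sub0v.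
case: (ex_minnP ex_j) => -[|j] HjU minj; first by rewrite HjU in HnU.
have HjH : (lower_central H j <= H)%VS.
  elim: j {HjU minj} => //= j IHj; apply: lbrv_subP => u w /(subvP IHj).
  exact: cH.
have [b [y [yHj yb yU]]] :
    exists b y, [/\ y \in lower_central H j, y \in homog L b & y \notin U].
  apply: contrapT => no_y; suff /minj : (lower_central H j <= U)%VS by rewrite ltnn.
  apply/subvP; apply: (graded_ind (graded_lower_central j gH)).
    by move=> u v; apply: rpredD.
  move=> a u uHj ua; apply: contraT => uU; case: no_y.
  by exists a, u.
have yH := subvP HjH _ yHj.
have HyU h : h \in H -> [<h, y>] \in U.
  by move=> hH; apply: (subvP HjU); apply: lower_central_lbr.
have: good (\dim (U + <[y]>)%VS).
  apply/asboolP; exists (U + <[y]>)%VS => //; split.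
  - exact: graded_add gU (graded_line yb).
  - by rewrite subv_add UH -memvE.
  - move=> h _ hH /memv_addP[u uU [_ /vlineP[c ->] ->]].
    apply: (subvP (addvSl _ _)).
    rewrite linearDr rpredD //; first exact: HU.
    by rewrite linearZr_LR memvZ // HyU.
  apply: (acts_nilpotently_add gU yb) => //.
  - by move=> u; apply: HU.
  - by move=> u v /(subvP UH); apply: HM.
  - by move=> v; apply: HM.
  move=> v vM; case: b yb => yb; last exact: Hnil.
  have [m yym] : engelizer [<y, y>] v.
    by apply: Hnil => //; [apply: cH | apply: (lbr_homog yb yb)].
  by exists m.*2; apply: odd_lbr_iter.
move=> /maxn; rewrite -dimU => le_dim; case/negP: yU.
have /eqP -> : (U == U + <[y]>)%VS by rewrite eqEdim addvSl le_dim.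
exact: subvP (addvSr _ _) _ (memv_line y).
Qed.

(** * Derivations and the nilpotentizer *)

Lemma graded_components U u w : graded U -> u \in homog L false ->
  w \in homog L true -> u + w \in U -> u \in U /\ w \in U.
Proof.
move=> gU u0 w1; rewrite {1}gU => /memv_addP[a + [c + uw]].
rewrite !memv_cap => /andP[aU a0] /andP[cU c1].
have E : u - a = c - w.
  by apply/eqP; rewrite subr_eq addrAC eq_sym subr_eq uw addrC.
have: u - a \in (homog L false :&: homog L true)%VS.
  by rewrite memv_cap rpredB // E rpredB.
rewrite homog_cap memv0 => d0; split.
  by move: d0; rewrite subr_eq0 => /eqP->.
by move: d0; rewrite E subr_eq0 => /eqP<-.
Qed.

Lemma nilpotentizer_sub_engel : nilpotentizer L `<=` engel_elements L.
Proof.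
move=> x xnil z; have [[gH _] zH xH _] := subalg_genP z x.
exact: nilpotent_subalg_engel gH (xnil z) zH xH.
Qed.

(** The algebra <u + w, x> is nilpotent by the choice of x; being graded, it
contains both u and w. *)
Lemma nilpotentizer_even_odd x u w : nilpotentizer L x ->
  u \in homog L false -> w \in homog L true -> engelizer u w.
Proof.
move=> xnil u0 w1; have [[gH _] uwH _ _] := subalg_genP (u + w) x.
have [uH wH] := graded_components gH u0 w1 uwH.
exact: nilpotent_subalg_engel gH (xnil _) uH wH.
Qed.

Lemma engel_even_derivation (D : 'End(L)) x :
  homog_derivation false D -> engel_elements L x -> engel_elements L (D x).
Proof.
move=> [_ Dlbr] xE z; exists (\dim {:L}).
have DE y v : D [<y, v>] = [<D y, v>] + [<y, D v>].
  move: y (memvf y); apply: (graded_ind graded_full) => [y y' ey ey' | a y _ ya].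
    by rewrite !(linearDl, linearD) /= ey ey' addrACA.
  by rewrite (Dlbr _ _ _ ya) scale1r.
have [n /nilpotent_at_dim zx0] := xE z.
have := iter_twisted_derivation (f := lbr L z) (g := lbr L (D z)) x
  (\dim {:L}) (DE z).
rewrite zx0 linear0 iter_variation_eq0 ?add0r // => t.
have [m /nilpotent_at_dim <-] := xE (z + t *: D z).
by apply: eq_iter => v; rewrite /= linearDl linearZl_LR.
Qed.

(** Since u is even, D is a derivation on brackets [u, v] in the ordinary sense:
[u, D v] = D [u, v] - [D u, v], and induction on the order of nilpotency at v
applies to [u, v]. *)
Lemma engelizer_odd_derivation (D : 'End(L)) u v :
  homog_derivation true D -> u \in homog L false ->
  engelizer u (D u) -> engelizer u v -> engelizer u (D v).
Proof.
move=> [_ Dlbr] u0 uDu [n]; elim: n v => [|n IHn] v.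
  by move=> /= ->; rewrite linear0; exists 0%N.
move=> unv; have /IHn[m uDuv] : iter n (lbr L u) [<u, v>] = 0 by rewrite -iterSr.
have [p uDuv'] : engelizer u [<D u, v>].
  by apply: engelizer_lbr => //; exists n.+1.
have uDv : [<u, D v>] = -1 *: [<D u, v>] + D [<u, v>].
  by rewrite (Dlbr _ _ _ u0) scale1r scaleN1r addKr.
have [q uq] : engelizer u [<u, D v>].
  by rewrite uDv; apply: engelizer_linear; [exists p | exists m].
by exists q.+1; rewrite iterSr.
Qed.

Lemma nilpotentizer_odd_derivation (D : 'End(L)) x :
  homog_derivation true D -> nilpotentizer L x -> engel_elements L (D x).
Proof.
move=> Dodd xnil z; have [[gH cH] zH xH _] := subalg_genP z x.
move: (xnil z) gH cH zH xH; set H := subalg_gen z x => Hnil gH cH zH xH.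
pose P v := forall u, u \in H -> u \in homog L false -> engelizer u v.
have [M MP] : exists M : {vspace L}, forall v, v \in M <-> P v.
  apply: vspace_comprehension => [u _ _|a v w Pv Pw u uH u0]; first by exists 0%N.
  by apply: engelizer_linear; [exact: Pv | exact: Pw].
have Mx : D x \in M.
  apply/MP => u uH u0; apply: engelizer_odd_derivation => //.
    by apply: (nilpotentizer_even_odd xnil u0); exact: (proj1 Dodd false u u0).
  exact: nilpotent_subalg_engel gH Hnil uH xH.
apply: (acts_nilpotently_at (U := H) (M := M)) => //.
apply: nilpotent_subalg_acts_nilpotently => // [h v hH /MP Pv | u v uH u0 /MP].
  apply/MP => u uH u0; apply: engelizer_lbr => //; last exact: Pv.
  exact: nilpotent_subalg_engel gH Hnil uH hH.
exact.
Qed.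

End LieSuperalgebra.

Theorem theorem4 (R : realType) (L : lieSuperalgebra R[i]) (D : 'End(L))
    (hD : derivation D) :
  [set D x | x in nilpotentizer L] `<=` engel_elements L.
Proof.
case: hD => D0 [D1 [even_D0 odd_D1 ->]] _ [x xnil <-] z.
have Ez0 := engel_even_derivation even_D0 (nilpotentizer_sub_engel xnil) z.
have Ez1 := nilpotentizer_odd_derivation odd_D1 xnil z.
rewrite add_lfunE -[D0 x]scale1r.
exact: engelizer_linear.
Qed.
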